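(* Every direct decomposition $M_3(\mathbb{C}) = S\oplus M$ into two subalgebras with $\dim S = 3$ and $\dim M = 6$, neither of which contains the identity matrix, is, up to transpose and up to the action of $\mathrm{Aut}(M_3(\mathbb{C}))$, one of the following decompositions (the first summand is $S$, the second is $M$): (A1) $\mathrm{Span}\{e_{11},e_{21},e_{31}\} \oplus \mathrm{Span}\{e_{12},e_{13},e_{22},e_{23},e_{32},e_{33}\}$, (A2) $\mathrm{Span}\{e_{11}+e_{22},e_{21},e_{31}\} \oplus \mathrm{Span}\{e_{12},e_{13},e_{22},e_{23},e_{32},e_{33}\}$, (A3) $\mathrm{Span}\{e_{11}+e_{22},e_{21}+e_{22},e_{31}\} \oplus \mathrm{Span}\{e_{12},e_{13},e_{22},e_{23},e_{32},e_{33}\}$. Moreover, the decompositions (A1), (A2), (A3) lie in pairwise different orbits under the action of automorphisms and antiautomorphisms of $M_3(\mathbb{C})$.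
   Context: $M_3(\mathbb{C})$ is the associative $\mathbb{C}$-algebra of $3\times 3$ complex matrices, and $e_{ij}$ denotes the matrix unit with $1$ in position $(i,j)$ and $0$ elsewhere. A subalgebra is a $\mathbb{C}$-linear subspace closed under multiplication (it is not required to contain the identity matrix, nor to be an ideal). $\mathrm{Span}$ denotes the $\mathbb{C}$-linear span. A direct decomposition $M_3(\mathbb{C}) = S\oplus M$ means that $S$ and $M$ are subalgebras, $S+M=M_3(\mathbb{C})$ and $S\cap M=(0)$, i.e. the sum is a direct sum of vector spaces. $\mathrm{Aut}(M_3(\mathbb{C}))$ is the group of $\mathbb{C}$-algebra automorphisms; antiautomorphisms are bijective $\mathbb{C}$-linear maps reversing products. These maps act on decompositions by $\varphi\cdot(S\oplus M)=\varphi(S)\oplus\varphi(M)$. ''Up to transpose and up to the action of $\mathrm{Aut}(M_3(\mathbb{C}))$'' means: there is an automorphism $\varphi$ such that either $\varphi$, or the composition of $\varphi$ with the transpose map $X\mapsto X^T$, carries $S$ and $M$ simultaneously onto the corresponding summands of a decomposition in the list. *)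

(* Defs.v *)
From HB Require Import structures.
From mathcomp Require Import all_boot all_order all_algebra.
From mathcomp Require Import complex reals.
Set Implicit Arguments.
Unset Strict Implicit.
Unset Printing Implicit Defensive.
Import GRing.Theory.
Local Open Scope ring_scope.

Section Decompositions.
Variable R : realType.
Local Notation M3 := 'M[R[i]]_3.

(* No unit is required: a subalgebra need not contain the identity matrix, so
   {aspace M3} (which demands an internal unit) would be too restrictive. *)
Definition is_subalgebra (U : {vspace M3}) : Prop :=
  forall x y : M3, x \in U -> y \in U -> x *m y \in U.

Definition is_decomposition (S M : {vspace M3}) : Prop :=
  [/\ is_subalgebra S, is_subalgebra M,
      (S + M = fullv)%VS & (S :&: M = 0)%VS].

Definition is_nonunital_36 (S M : {vspace M3}) : Prop :=
  [/\ is_decomposition S M, \dim S = 3%N, \dim M = 6%N,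
      (1%:M : M3) \notin S & (1%:M : M3) \notin M].

Definition is_automorphism (f : 'End(M3)) : Prop :=
  bijective f /\ (forall x y : M3, f (x *m y) = f x *m f y).

Definition is_antiautomorphism (f : 'End(M3)) : Prop :=
  bijective f /\ (forall x y : M3, f (x *m y) = f y *m f x).

Definition transposition : 'End(M3) := linfun (@trmx R[i] 3 3).

(* A pair of subspaces (S, M) stands for the decomposition S (+) M. *)
Definition carries (f : 'End(M3)) (D D' : {vspace M3} * {vspace M3}) : Prop :=
  (f @: D.1)%VS = D'.1 /\ (f @: D.2)%VS = D'.2.

(* Composing with the transpose on the other side gives the same relation,
   since X |-> (phi X^T)^T is again an automorphism. *)
Definition equiv_up_to_transpose (D D' : {vspace M3} * {vspace M3}) : Prop :=
  exists phi : 'End(M3), is_automorphism phi /\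
    (carries phi D D' \/ carries (phi \o transposition)%VF D D').

Definition same_orbit (D D' : {vspace M3} * {vspace M3}) : Prop :=
  exists f : 'End(M3),
    (is_automorphism f \/ is_antiautomorphism f) /\ carries f D D'.

(* Matrix units with 1-based indices i, j in {1, 2, 3}. *)
Definition e (i j : nat) : M3 := delta_mx (inord i.-1) (inord j.-1).

Definition summand6 : {vspace M3} :=
  span [:: e 1 2; e 1 3; e 2 2; e 2 3; e 3 2; e 3 3].

Definition A1 : {vspace M3} * {vspace M3} :=
  (span [:: e 1 1; e 2 1; e 3 1], summand6).

Definition A2 : {vspace M3} * {vspace M3} :=
  (span [:: e 1 1 + e 2 2; e 2 1; e 3 1], summand6).

Definition A3 : {vspace M3} * {vspace M3} :=
  (span [:: e 1 1 + e 2 2; e 2 1 + e 2 2; e 3 1], summand6).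

End Decompositions.

Arguments A1 R : clear implicits.
Arguments A2 R : clear implicits.
Arguments A3 R : clear implicits.

(* Main.v *)
Require Import Defs.
From mathcomp Require Import all_boot all_order all_algebra.
From mathcomp Require Import complex reals.

(** The plan is to pin down the six-dimensional summand M first, and then to
    read S as an abstract three-dimensional algebra.

    Adjoining the identity to M gives a unital subalgebra A of dimension 7.
    For dimension reasons A contains a rank one matrix u *m w.  If no nonzero
    row f and column x satisfied f *m X *m x = 0 for all X in A, then
    the vectors X *m u and w *m X would span everything, so A would
    contain all rank one matrices, hence everything.  So A is reducible, and
    in dimension 3 this means that A, hence M, preserves a line of column vectors
    or a line of row vectors ([reducible_preserves_line],
    [dim7_subalgebra_preserves_line]).  Transposition exchanges the two
    cases, so let M preserve the line of v.  Then A is the full stabilizer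
    of that line, M is an ideal of A with quotient the base field, and the
    resulting character of A vanishes on the 2 x 2 matrix algebra inside A.
    Hence M consists exactly of the matrices that kill v
    ([nonunital_stabilizer_is_annihilator]).

    Consequently s |-> s *m v is a linear bijection from S onto the column
    vectors.  Let E in S correspond to v.  Then E is a right identity of S, an
    idempotent different from the identity matrix, and the elements of S kill
    the kernel of E.  If E has rank 1, then S is (A1) in a basis made of v
    and of a basis of ker E.  If E has rank 2, a basis v, w, n with E w = w and
    E n = 0 can be adjusted so that the element of S taking v to n kills w;
    associativity then forces the element taking v to w to satisfy
    w |-> b w, and b = 0 gives (A2) while b <> 0 gives (A3) after rescaling
    ([nonunital_complement_normal_form]).  Conjugation by the matrix of the
    basis is the required automorphism.

    The three orbits are separated by squares in S, which automorphisms and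
    antiautomorphisms both respect: x^2 is a multiple of x for every x only
    in (A1), and the elements of square zero form a line in (A3) but a plane
    in (A2). *)

Set Implicit Arguments.
Unset Strict Implicit.
Unset Printing Implicit Defensive.
Import GRing.Theory.
Local Open Scope ring_scope.

(** * Linear algebra over a field *)

(** The product here is [muln], the form used by the arithmetic of dimensions,
    whereas that of [dim_matrix] is the product of [nat] as a semiring. *)
Lemma dim_fullmx (F : fieldType) m n :
  \dim (fullv : {vspace 'M[F]_(m, n)}) = (m * n)%N.
Proof. by rewrite dimvf dim_matrix. Qed.

Lemma delta_mx_neq0 (F : fieldType) m n i j :
  delta_mx i j != 0 :> 'M[F]_(m, n).
Proof. by apply/matrix0Pn; exists i, j; rewrite mxE !eqxx oner_eq0. Qed.

Lemma exists_dual_row (F : fieldType) n (v : 'cV[F]_n) :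
  v != 0 -> exists w : 'rV[F]_n, w *m v = 1%:M.
Proof.
move=> /cV0Pn[i vi]; exists ((v i 0)^-1 *: delta_mx 0 i); apply/matrixP => a b.
by rewrite !ord1 -scalemxAl -rowE !mxE eqxx mulVf.
Qed.

(** Gaussian elimination of the column v gives v = L *m pid_mx 1 *m d with L
    invertible and d a nonzero 1 x 1 matrix, so that L scaled by d is a solution. *)
Lemma exists_unit_col0 (F : fieldType) n (v : 'cV[F]_n.+1) :
  v != 0 -> exists2 T : 'M[F]_n.+1, T \in unitmx & col 0 T = v.
Proof.
move=> v0; have rv : \rank v = 1%N.
  by rewrite -mxrank_tr rank_rV trmx_eq0; case: (v == 0) v0.
have d0 : (row_ebase v) 0 0 != 0.
  by have := row_ebase_unit v; rewrite unitmxE det_mx11 unitfE.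
exists ((row_ebase v) 0 0 *: col_ebase v).
  by rewrite unitmxZ ?unitfE ?d0 // col_ebase_unit.
have {3}<- := mulmx_ebase v; rewrite rv {2}[row_ebase v]mx11_scalar mul_mx_scalar.
rewrite colE -scalemxAl; congr (_ *: (_ *m _)).
by apply/matrixP => -[[|i] ?] j; rewrite !mxE !ord1.
Qed.

Lemma exists_annihilating_row (F : fieldType) n (U : {vspace 'cV[F]_n}) :
  (\dim U < n)%N ->
  exists2 f : 'rV[F]_n, f != 0 & forall x, x \in U -> f *m x = 0.
Proof.
move=> dU; pose B := \matrix_(i < n, j < \dim U) (vbasis U)`_j i 0.
have kB : kermx B != 0.
  rewrite -mxrank_eq0 mxrank_ker subn_eq0 -ltnNge.
  exact: leq_ltn_trans (rank_leq_col B) dU.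
exists (nz_row (kermx B)); first by rewrite nz_row_eq0.
move=> x /coord_vbasis ->; rewrite mulmx_sumr big1 // => j _.
rewrite -scalemxAr; have -> : (vbasis U)`_j = col j B.
  by apply/colP => i; rewrite !mxE.
by rewrite colE mulmxA (sub_kermxP (nz_row_sub _)) mul0mx scaler0.
Qed.

Lemma dim_annihilator (F : fieldType) n (v : 'cV[F]_n) :
  v != 0 -> (\dim (lker (linfun (mulmxr v : 'M[F]_n -> 'cV[F]_n))) + n = n * n)%N.
Proof.
move=> /exists_dual_row[w wv]; set f := linfun _.
have := limg_ker_dim f fullv; rewrite capfv dim_fullmx.
suff -> : limg f = fullv by rewrite dim_fullmx muln1.
apply/vspaceP => y; rewrite memvf; apply/memv_imgP; exists (y *m w).
  exact: memvf.
by rewrite lfunE /= -mulmxA wv mulmx1.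
Qed.

(** The matrices u *m w with w fixed form a space of dimension n, which must
    meet every subspace of codimension less than n. *)
Lemma rank_one_in_large_subspace (F : fieldType) n
    (A : {vspace 'M[F]_n}) (w : 'rV[F]_n) :
  w != 0 -> (n * n < \dim A + n)%N ->
  exists2 u : 'cV[F]_n, u != 0 & u *m w \in A.
Proof.
move=> w0 dA; pose f : 'Hom('cV[F]_n, 'M[F]_n) := linfun (mulmxr w).
have [x wx] : exists x : 'cV[F]_n, w *m x = 1%:M.
  have [|x wx] := @exists_dual_row F n w^T.
    by rewrite trmx_eq0.
  by exists x^T; apply: trmx_inj; rewrite trmx_mul trmxK wx trmx1.
have fI : (fullv :&: lker f = 0)%VS.
  apply/eqP; rewrite capfv -subv0; apply/subvP => u; rewrite memv_ker lfunE /=.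
  by move=> /eqP uw; rewrite memv0 -[u]mulmx1 -wx mulmxA uw mul0mx.
have dI : \dim (limg f) = n by rewrite (limg_dim_eq fI) dim_fullmx muln1.
have : (A :&: limg f != 0)%VS.
  apply: contraTneq dA => cap0; rewrite -leqNgt.
  have := dimv_sum_cap A (limg f); rewrite cap0 dimv0 addn0 dI => <-.
  by rewrite (leq_trans (dimvS (subvf _))) // dim_fullmx.
rewrite -vpick0; have := memv_pick (A :&: limg f)%VS.
rewrite memv_cap => /andP[xA /memv_imgP[u _ xE]] x0.
move: xE xA x0; rewrite lfunE /= => -> uA u0; exists u => //.
by apply: contraNneq u0 => ->; rewrite mul0mx.
Qed.

Lemma row_annihilator_of_plane (F : fieldType) (f g : 'rV[F]_3)
    (u v : 'cV[F]_3) :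
  f != 0 -> u != 0 -> (forall c, v <> c *: u) ->
  f *m u = 0 -> f *m v = 0 -> g *m u = 0 -> g *m v = 0 ->
  exists c, g = c *: f.
Proof.
move=> f0 u0 vu fu fv gu gv; pose B := row_mx u v.
have rB : (1 < \rank B)%N.
  have uB : (u^T <= col_mx u^T v^T)%MS by rewrite -addsmxE addsmxSl.
  have ru : \rank u^T = 1%N by rewrite rank_rV trmx_eq0; case: (u == 0) u0.
  rewrite ltnNge; apply/negP => rB1.
  have : (col_mx u^T v^T <= u^T)%MS.
    by rewrite -(geq_leqif (mxrank_leqif_sup uB)) ru -tr_row_mx mxrank_tr.
  rewrite -addsmxE addsmx_sub => /andP[_ /sub_rVP[c vc]].
  by apply: (vu c); apply: trmx_inj; rewrite vc linearZ.
have sub (x : 'rV[F]_3) : x *m u = 0 -> x *m v = 0 -> (x <= kermx B)%MS.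
  by move=> xu xv; apply/sub_kermxP; rewrite mul_mx_row xu xv row_mx0.
have fB := sub f fu fv; apply/sub_rVP/(submx_trans (sub g gu gv)).
rewrite -(geq_leqif (mxrank_leqif_sup fB)) mxrank_ker rank_rV f0.
by rewrite leq_subLR; exact: (leq_add rB (leqnn 1)).
Qed.

(** * Seven-dimensional subalgebras are reducible *)

Definition preserves_line (F : fieldType) (A : {vspace 'M[F]_3}) : Prop :=
  (exists2 v : 'cV[F]_3, v != 0 & forall X, X \in A -> exists c, X *m v = c *: v)
  \/
  (exists2 w : 'rV[F]_3, w != 0 & forall X, X \in A -> exists c, w *m X = c *: w).

(** A proper nonzero invariant subspace of a space of dimension 3 is a line or
    a plane, and an invariant plane is an invariant line of row vectors.
    Here the subspace is spanned by the X *m u: if it is larger than the line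
    of u, the rows f and f *m Y both vanish on a plane, hence are
    proportional. *)
Lemma reducible_preserves_line (F : fieldType) (A : {vspace 'M[F]_3})
    (u : 'cV[F]_3) (f : 'rV[F]_3) :
  (forall X Y, X \in A -> Y \in A -> X *m Y \in A) -> 1%:M \in A ->
  u != 0 -> f != 0 -> (forall X, X \in A -> f *m X *m u = 0) ->
  preserves_line A.
Proof.
move=> AM A1 u0 f0 fAu.
have [/subvP Au | /subvPn[X XA Xu]] :=
    boolP (A <= linfun (mulmxr u) @^-1: <[u]>)%VS.
  left; exists u => // X /Au; rewrite -memv_preim lfunE /= => /vlineP[c Xu].
  by exists c.
right; exists f => // Y YA.
apply: (@row_annihilator_of_plane _ _ _ u (X *m u)) => //.
- move=> c Xuc; case/negP: Xu; rewrite -memv_preim lfunE /=; apply/vlineP.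
  by exists c.
- by rewrite -[f]mulmx1 fAu.
- by rewrite mulmxA fAu.
- by rewrite fAu.
- by rewrite mulmxA -[f *m Y *m X]mulmxA fAu // AM.
Qed.

(** Starting from a rank one matrix u *m w in A, the spaces U of the X *m u
    and W of the w *m X cannot both be full, because A contains U *m W.  A
    functional that vanishes on one of them witnesses reducibility. *)
Lemma dim7_subalgebra_preserves_line (F : fieldType) (A : {vspace 'M[F]_3}) :
  (forall X Y, X \in A -> Y \in A -> X *m Y \in A) ->
  1%:M \in A -> \dim A = 7%N -> preserves_line A.
Proof.
move=> AM A1 dA.
have w0 : (delta_mx 0 0 : 'rV[F]_3) != 0 := delta_mx_neq0 F _ _.
have [|u u0 uwA] := rank_one_in_large_subspace (A := A) w0; first by rewrite dA.
set w := delta_mx 0 0 in w0 uwA.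
pose U := (linfun (mulmxr u) @: A)%VS.
pose W := (linfun (mulmx w) @: A)%VS.
have [dU | dU] := ltnP (\dim U) 3.
  have [f f0 fU] := exists_annihilating_row dU.
  apply: (reducible_preserves_line AM A1 u0 f0) => X XA.
  rewrite -mulmxA; apply: fU.
  by apply/memv_imgP; exists X => //; rewrite lfunE.
have Ufull x : x \in U.
  suff -> : U = fullv by exact: memvf.
  by apply/eqP; rewrite eqEdim subvf dim_fullmx.
(* Row vectors are turned into columns to reuse the annihilator of a space of
   columns. *)
have [dW | dW] := ltnP (\dim W) 3.
  have [|f f0 fW] := @exists_annihilating_row F 3 (linfun (@trmx F 1 3) @: W)%VS.
    apply: leq_ltn_trans dW.
    by rewrite -[X in (_ <= X)%N](limg_ker_dim (linfun (@trmx F 1 3))) leq_addl.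
  have ft0 : f^T != 0 by rewrite trmx_eq0.
  apply: (reducible_preserves_line AM A1 ft0 w0).
  move=> X XA; apply: trmx_inj; rewrite trmx_mul trmxK trmx0; apply: fW.
  apply/memv_imgP; exists (w *m X); rewrite ?lfunE //.
  by apply/memv_imgP; exists X; rewrite ?lfunE.
have Wfull x : x \in W.
  suff -> : W = fullv by exact: memvf.
  by apply/eqP; rewrite eqEdim subvf dim_fullmx.
have prodA (a : 'cV[F]_3) (b : 'rV[F]_3) : a *m b \in A.
  have /memv_imgP[X XA ->] := Ufull a; have /memv_imgP[Y YA ->] := Wfull b.
  by rewrite !lfunE /= mulmxA -(mulmxA X) AM ?AM.
suff : A = fullv by move=> Af; move: dA; rewrite Af dim_fullmx.
apply/vspaceP => X; rewrite memvf.
rewrite [X]matrix_sum_delta; apply: memv_suml => i _; apply: memv_suml => j _.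
by rewrite memvZ // -(mul_delta_mx (0 : 'I_1)).
Qed.

(** * Six-dimensional nonunital subalgebras *)

Lemma scalar_mem_nonunital (F : fieldType) n (M : {vspace 'M[F]_n}) c :
  1%:M \notin M -> c%:M \in M -> c = 0.
Proof.
move=> M1 cM; apply/eqP; apply: contraNT M1 => c0.
by have := memvZ c^-1 cM; rewrite scale_scalar_mx mulVf.
Qed.

Lemma dim_adjoin_unit (F : fieldType) n (M : {vspace 'M[F]_n}) :
  1%:M \notin M -> \dim (M + <[1%:M]>) = (\dim M).+1.
Proof.
move=> M1; rewrite dimv_disjoint_sum ?dim_vline.
  by case: (1%:M =P 0) M1 => [->|_ _]; rewrite ?mem0v // addn1.
apply/eqP; rewrite -subv0; apply/subvP => X; rewrite memv_cap memv0.
case/andP => XM /vlineP[c Xc]; move: XM; rewrite Xc scalemx1.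
by move/(scalar_mem_nonunital M1) ->; rewrite -scalemx1 scale0r.
Qed.

Lemma nonunital_preserves_line (F : fieldType) (M : {vspace 'M[F]_3}) :
  (forall X Y, X \in M -> Y \in M -> X *m Y \in M) ->
  1%:M \notin M -> \dim M = 6%N -> preserves_line M.
Proof.
move=> MM M1 dM; pose A := (M + <[1%:M]>)%VS.
have MA : (M <= A)%VS by apply: addvSl.
have A1 : 1%:M \in A by apply: (subvP (addvSr _ _)); apply: memv_line.
have AM X Y : X \in A -> Y \in A -> X *m Y \in A.
  move=> /memv_addP[m mM [_ /vlineP[c ->] ->]].
  move=> /memv_addP[m' mM' [_ /vlineP[c' ->] ->]].
  rewrite !scalemx1 mulmxDl !mulmxDr mul_mx_scalar mul_scalar_mx -scalar_mxM.
  rewrite -[(c * c')%:M]scalemx1.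
  by rewrite !memvD ?memvZ // (subvP MA) // MM.
have dA : \dim A = 7%N by rewrite (dim_adjoin_unit M1) dM.
have [] := dim7_subalgebra_preserves_line AM A1 dA => -[v v0 Av];
  [left | right]; exists v => // X XM; apply: Av; exact: (subvP MA).
Qed.

(** With the identity adjoined, M becomes by dimension the full stabilizer P of
    the line of v, so M is the kernel of a character chi of P.  In a basis
    starting with v, the annihilator of v has the right identity
    e_22 + e_33.  Now chi e_22 * chi e_33 = chi 0 = 0, while
    chi e_22 = chi e_23 * chi e_32 = chi e_33, so chi kills this right identity,
    and with it the whole annihilator of v. *)
Lemma nonunital_stabilizer_is_annihilator (F : fieldType)
    (M : {vspace 'M[F]_3}) (v : 'cV[F]_3) :
  (forall X Y, X \in M -> Y \in M -> X *m Y \in M) ->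
  1%:M \notin M -> \dim M = 6%N -> v != 0 ->
  (forall X, X \in M -> exists c, X *m v = c *: v) ->
  forall X, (X \in M) = (X *m v == 0).
Proof.
move=> MM M1 dM v0 Mv.
pose f : 'Hom('M[F]_3, 'cV[F]_3) := linfun (mulmxr v).
have fE X : f X = X *m v by rewrite lfunE.
have dK : \dim (lker f) = 6%N.
  by apply/eqP; rewrite -(eqn_add2r 3); apply/eqP; apply: dim_annihilator.
pose P := (f @^-1: <[v]>)%VS.
have dP : (\dim P <= 7)%N.
  rewrite -(limg_ker_dim f P); apply: (leq_add (n1 := 6) (n2 := 1)).
    by rewrite -[6%N]dK dimvS // capvSr.
  apply: (leq_trans (dimvS (_ : (f @: P <= <[v]>)%VS))).
    2: by rewrite dim_vline v0.
  by apply/subvP => _ /memv_imgP[X XP ->]; rewrite memv_preim.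
have scalar0 c := @scalar_mem_nonunital F 3 M c M1.
have PE : (M + <[1%:M]>)%VS = P.
  apply/eqP; rewrite eqEdim; apply/andP; split.
    rewrite subv_add -memvE; apply/andP; split.
      apply/subvP => X /Mv[c Xv]; rewrite -memv_preim fE Xv.
      by rewrite memvZ // memv_line.
    by rewrite -memv_preim fE mul1mx memv_line.
  by rewrite (dim_adjoin_unit M1) dM.
have decomp X : X *m v = 0 -> exists2 m, m \in M & exists c, X = m + c%:M.
  move=> Xv; have : X \in P by rewrite -memv_preim fE Xv mem0v.
  rewrite -PE => /memv_addP[m mM [_ /vlineP[c ->] ->]].
  by exists m => //; exists c; rewrite scalemx1.
(* The character sends m + a to a; it is multiplicative because M is closed
   under products and contains no nonzero scalar matrix. *)
have chi_mul m1 m2 m3 a b d : m1 \in M -> m2 \in M -> m3 \in M ->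
    (m1 + a%:M) *m (m2 + b%:M) = m3 + d%:M -> a * b = d.
  move=> h1 h2 h3 E; apply/eqP; rewrite -subr_eq0; apply/eqP; apply: scalar0.
  move: E; rewrite mulmxDl !mulmxDr mul_mx_scalar !mul_scalar_mx addrA.
  rewrite scale_scalar_mx; set W := _ + _ + a *: m2 => E.
  have -> : (a * b - d)%:M = m3 - W.
    have abE : (a * b)%:M = m3 + d%:M - W by rewrite -E addrAC subrr add0r.
    by rewrite raddfB /= abE addrAC addrK.
  by rewrite rpredB ?rpredD ?memvZ // MM.
have [T Tu Tv] := exists_unit_col0 v0.
(* The matrix units in the basis given by the columns of T. *)
pose E i j := T *m delta_mx i j *m invmx T.
have EE i j k l : E i j *m E k l = T *m (delta_mx i j *m delta_mx k l) *m invmx T.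
  by rewrite /E -!mulmxA (mulmxA (invmx T)) mulVmx // mul1mx.
have EM i j l : E i j *m E j l = E i l by rewrite EE mul_delta_mx.
have E0 i j k l : j != k -> E i j *m E k l = 0.
  by move=> jk; rewrite EE mul_delta_mx_0 // mulmx0 mul0mx.
have vE : v = T *m delta_mx 0 0 by rewrite -Tv colE.
have Ev i j : j != 0 -> E i j *m v = 0.
  move=> j0; rewrite vE /E -mulmxA (mulmxA (invmx T)) mulVmx // mul1mx -mulmxA.
  by rewrite mul_delta_mx_0 // mulmx0.
have E_in_M (i j : 'I_3) : i != 0 -> j != 0 -> i != j -> E i i \in M.
  move=> i0 j0 ij.
  have [m1 M1' [a e1]] := decomp _ (Ev i i i0).
  have [m2 M2' [b e2]] := decomp _ (Ev j j j0).
  have [m3 M3' [c e3]] := decomp _ (Ev i j j0).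
  have [m4 M4' [d e4]] := decomp _ (Ev j i i0).
  have ab : a * b = 0.
    apply: (chi_mul m1 m2 0); rewrite ?mem0v // -e1 -e2 E0 //.
    by rewrite add0r -scalemx1 scale0r.
  have cda : c * d = a by apply: (chi_mul m3 m4 m1); rewrite // -e1 -e3 -e4 EM.
  have dcb : d * c = b by apply: (chi_mul m4 m3 m2); rewrite // -e2 -e3 -e4 EM.
  have a_b : a = b by rewrite -cda mulrC.
  have a0 : a = 0 by apply/eqP; rewrite -sqrf_eq0 expr2 {2}a_b ab.
  by rewrite e1 a0 -scalemx1 scale0r addr0.
have KM : (lker f <= M)%VS.
  apply/subvP => X; rewrite memv_ker fE => /eqP Xv.
  have XE : X = X *m (E 1 1 + E ord_max ord_max).
    have XE0 : X *m E 0 0 = 0.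
      by rewrite /E -(mul_delta_mx (0 : 'I_1)) mulmxA -vE 2!mulmxA Xv !mul0mx.
    have : E 0 0 + (E 1 1 + E ord_max ord_max) = 1%:M.
      rewrite -!mulmxDl -!mulmxDr -[RHS](mulmxV Tu) -[X in _ = X *m _]mulmx1.
      congr (_ *m _ *m _); apply/matrixP => -[[|[|[|i]]] hi] -[[|[|[|j]]] hj] //;
      by rewrite !mxE //= ?addr0 ?add0r.
    by move=> sumE; rewrite -[LHS]mulmx1 -sumE mulmxDr XE0 add0r.
  have rM : E 1 1 + E ord_max ord_max \in M.
    by apply: rpredD; [apply: (E_in_M _ ord_max) | apply: (E_in_M _ 1)].
  have [m mM [c Xm]] := decomp _ Xv.
  by rewrite XE Xm mulmxDl mul_scalar_mx rpredD ?memvZ ?MM.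
have /eqP KE : (lker f == M)%VS by rewrite eqEdim KM dK dM.
by move=> X; rewrite -KE memv_ker fE.
Qed.

(** * Complements of the annihilator of a vector *)

Definition col3 (F : fieldType) (u v w : 'cV[F]_3) : 'M[F]_3 :=
  \matrix_(i, j) nth 0 [:: u i 0; v i 0; w i 0] j.

Lemma mul_col3 (F : fieldType) (A : 'M[F]_3) u v w :
  A *m col3 u v w = col3 (A *m u) (A *m v) (A *m w).
Proof.
apply/matrixP => i j; rewrite !mxE.
by case: j => [[|[|[|j]]] hj] //=; apply: eq_bigr => k _; rewrite mxE.
Qed.

Lemma col3_mulv (F : fieldType) (u v w x : 'cV[F]_3) :
  col3 u v w *m x = x 0 0 *: u + x 1 0 *: v + x ord_max 0 *: w.
Proof.
apply/colP => i; rewrite !mxE !big_ord_recl big_ord0 !mxE /= addr0 !addrA.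
rewrite !(mulrC (x _ _)).
by congr (_ * _ + _ * _ + _ * _); congr (x _ _); apply: val_inj.
Qed.

Lemma col_col3 (F : fieldType) (u v w : 'cV[F]_3) : col 0 (col3 u v w) = u.
Proof. by apply/colP => i; rewrite !mxE. Qed.

Lemma col3_mul (F : fieldType) (u v w : 'cV[F]_3) (A : 'M[F]_3) :
  col3 u v w *m A = col3 (col3 u v w *m col 0 A) (col3 u v w *m col 1 A)
                         (col3 u v w *m col ord_max A).
Proof.
rewrite -mul_col3; congr (_ *m _); apply/matrixP => i j; rewrite !mxE.
by case: j => [[|[|[|j]]] hj] //=; congr (A _ _); apply: val_inj.
Qed.

Lemma col3_unit (F : fieldType) (u v w : 'cV[F]_3) :
  (forall a b c, a *: u + b *: v + c *: w = 0 -> [/\ a = 0, b = 0 & c = 0]) ->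
  col3 u v w \in unitmx.
Proof.
move=> ind; rewrite -unitmx_tr -row_free_unit; apply: inj_row_free => x.
move/(congr1 trmx); rewrite trmx_mul trmxK trmx0 col3_mulv => /ind.
rewrite !mxE => -[x0 x1 x2]; apply/rowP => -[[|[|[|i]]] hi] //.
- by rewrite mxE -x0; congr (x _ _); apply: val_inj.
- by rewrite mxE -x1; congr (x _ _); apply: val_inj.
- by rewrite mxE -x2; congr (x _ _); apply: val_inj.
Qed.

Lemma mem_conj (F : fieldType) n (S : {vspace 'M[F]_n}) (s T A : 'M[F]_n) :
  T \in unitmx -> s \in S -> s *m T = T *m A -> T *m A *m invmx T \in S.
Proof. by move=> Tu sS <-; rewrite mulmxK. Qed.

(** The two hypotheses relating S to v say that s |-> s *m v is a bijection
    from S onto the columns; it transports the product of S to the columns, with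
    v as right identity, and equalities in S are checked at v.  The element E
    with E *m v = v satisfies s *m E = s, so S kills ker E.  The columns of T are
    v, a vector n of ker E, and a third vector, taken in ker E when v spans the
    fixed space of E, and in that fixed space otherwise. *)
Lemma nonunital_complement_normal_form (F : fieldType) (S : {vspace 'M[F]_3})
    (v : 'cV[F]_3) :
  (forall X Y, X \in S -> Y \in S -> X *m Y \in S) -> 1%:M \notin S ->
  v != 0 ->
  (forall x, exists2 s, s \in S & s *m v = x) ->
  (forall s, s \in S -> s *m v = 0 -> s = 0) ->
  exists2 T : 'M[F]_3, T \in unitmx /\ col 0 T = v &
    let c A := T *m A *m invmx T in
    [\/ [/\ c (delta_mx 0 0) \in S, c (delta_mx 1 0) \in S
          & c (delta_mx ord_max 0) \in S],
        [/\ c (delta_mx 0 0 + delta_mx 1 1) \in S, c (delta_mx 1 0) \in S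
          & c (delta_mx ord_max 0) \in S]
      | [/\ c (delta_mx 0 0 + delta_mx 1 1) \in S,
            c (delta_mx 1 0 + delta_mx 1 1) \in S
          & c (delta_mx ord_max 0) \in S]].
Proof.
move=> SM S1 v0 ex inj0.
have inj s t : s \in S -> t \in S -> s *m v = t *m v -> s = t.
  move=> sS tS st; apply/eqP; rewrite -subr_eq0; apply/eqP/inj0.
    by rewrite rpredB.
  by rewrite mulmxBl st subrr.
have [E ES Ev] := ex v.
have SE s : s \in S -> s *m E = s.
  by move=> sS; apply: inj; rewrite ?SM // -mulmxA Ev.
have Sker s n : s \in S -> E *m n = 0 -> s *m n = 0.
  by move=> sS En; rewrite -(SE s sS) -mulmxA En mulmx0.
have E_id x : E *m (x - E *m x) = 0.
  by rewrite mulmxBr mulmxA SE // subrr.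
have [n n0 En] : exists2 n : 'cV[F]_3, n != 0 & E *m n = 0.
  have /eqP : 1%:M - E <> 0 by move/subr0_eq => E1; rewrite E1 ES in S1.
  case/matrix0Pn => i [j ij].
  exists (col j (1%:M - E)).
    by apply: contraNneq ij => /colP/(_ i); rewrite !mxE => ->.
  by rewrite colE mulmxA mulmxBr mulmx1 SE // subrr mul0mx.
have [s3 s3S s3v] := ex n.
have s3n : s3 *m n = 0 by apply: Sker.
have Es3 : E *m s3 = 0.
  by apply: inj0; rewrite ?SM // -mulmxA s3v.
pose fixE := lker (linfun (mulmx (1%:M - E) : 'cV[F]_3 -> 'cV[F]_3)).
have fixEP x : reflect (E *m x = x) (x \in fixE).
  rewrite memv_ker lfunE /= mulmxBl mul1mx subr_eq0 eq_sym; exact: eqP.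
have [fix1 | /subvPn[w /fixEP Ew wv]] := boolP (fixE <= <[v]>)%VS.
  have : ~~ (fullv <= <[v]> + <[n]>)%VS.
    apply/negP => /dimvS; rewrite dim_fullmx.
    rewrite leqNgt (leq_ltn_trans (dimv_add_leqif <[v]> <[n]>).1) //.
    by rewrite !dim_vline v0 n0.
  case/subvPn => x _ xvn; pose w := x - E *m x.
  have Ew : E *m w = 0 by exact: E_id.
  have Ex : E *m x \in <[v]>%VS.
    by apply: (subvP fix1); apply/fixEP; rewrite mulmxA SE.
  have [s2 s2S s2v] := ex w.
  have Tu : col3 v w n \in unitmx.
    apply: col3_unit => a b c abc.
    have a0 : a = 0.
      move/(congr1 (mulmx E)): abc.
      rewrite !mulmxDr -!scalemxAr Ev Ew En !scaler0 !addr0 mulmx0 => /eqP.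
      by rewrite scaler_eq0 (negPf v0) orbF => /eqP.
    have b0 : b = 0.
      apply: contraNeq xvn => b0; apply/memv_addP; exists (E *m x) => //.
      exists w; last by rewrite addrC subrK.
      apply/vlineP; exists (- (b^-1 * c)); move: abc.
      rewrite a0 scale0r add0r => /eqP; rewrite addr_eq0 => /eqP bw.
      by rewrite scaleNr -scalerA -scalerN -bw scalerA mulVf // scale1r.
    move: abc; rewrite a0 b0 !scale0r !add0r => /eqP.
    by rewrite scaler_eq0 (negPf n0) orbF => /eqP ->.
  exists (col3 v w n); first by rewrite col_col3.
  apply: Or31; split.
  - apply: (mem_conj Tu ES); rewrite mul_col3 col3_mul !col3_mulv !mxE /=.
    by rewrite Ev Ew En !scale0r scale1r !addr0.
  - apply: (mem_conj Tu s2S); rewrite mul_col3 col3_mul !col3_mulv !mxE /=.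
    rewrite s2v (Sker _ s2 w) // (Sker _ s2 n) //.
    by rewrite !(add0r, addr0, scale0r, scale1r).
  - apply: (mem_conj Tu s3S); rewrite mul_col3 col3_mul !col3_mulv !mxE /=.
    by rewrite s3v (Sker _ s3 w) // s3n !(add0r, addr0, scale0r, scale1r).
have indep w' : E *m w' = w' -> w' \notin <[v]>%VS -> col3 v w' n \in unitmx.
  move=> Ew' w'v; apply: col3_unit => a b c abc.
  have ab : a *: v + b *: w' = 0.
    move/(congr1 (mulmx E)): abc.
    by rewrite !mulmxDr -!scalemxAr Ev Ew' En scaler0 addr0 mulmx0.
  have b0 : b = 0.
    apply: contraNeq w'v => b0; apply/vlineP; exists (- (b^-1 * a)).
    move/eqP: ab; rewrite addrC addr_eq0 => /eqP bw.
    by rewrite scaleNr -scalerA -scalerN -bw scalerA mulVf // scale1r.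
  move: abc; rewrite ab add0r => /eqP.
  rewrite scaler_eq0 (negPf n0) orbF => /eqP c0.
  move: ab; rewrite b0 scale0r addr0 => /eqP.
  by rewrite scaler_eq0 (negPf v0) orbF => /eqP a0.
have spanned w' x : E *m w' = w' -> w' \notin <[v]>%VS ->
    exists a b c, x = a *: v + b *: w' + c *: n.
  move=> Ew' w'v; have Tu := indep w' Ew' w'v.
  have := col3_mulv v w' n (invmx (col3 v w' n) *m x); rewrite mulKVmx //.
  by move=> ->; do 3 eexists.
have [c s3w] : exists c, s3 *m w = c *: n.
  have [a [b [c s3w]]] := spanned w (s3 *m w) Ew wv; exists c.
  move/(congr1 (mulmx E)): (s3w); rewrite mulmxA Es3 mul0mx.
  rewrite !mulmxDr -!scalemxAr Ev Ew En scaler0 addr0 => ab0.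
  by rewrite s3w -ab0 add0r.
(* This change of w makes the element of S that sends v to n kill it. *)
pose w1 := w - c *: v.
have Ew1 : E *m w1 = w1 by rewrite mulmxBr -scalemxAr Ev Ew.
have w1v : w1 \notin <[v]>%VS.
  apply: contra wv => w1v.
  by rewrite -(subrK (c *: v) w) memvD // memvZ // memv_line.
have s3w1 : s3 *m w1 = 0 by rewrite mulmxBr -scalemxAr s3v s3w subrr.
have [s2 s2S s2v] := ex w1.
have Es2 : E *m s2 = s2 by apply: inj; rewrite ?SM // -mulmxA s2v.
have s3s2 : s3 *m s2 = 0 by apply: inj0; rewrite ?SM // -mulmxA s2v.
(* Since s3 *m s2 = 0 and s3 *m w1 = 0, applying s3 to s2 *m w1 shows that its
   coordinate on v vanishes. *)
have [b s2w1] : exists b, s2 *m w1 = b *: w1.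
  have [a [b [d s2w]]] := spanned w1 (s2 *m w1) Ew1 w1v; exists b.
  have s2w' : s2 *m w1 = a *: v + b *: w1.
    rewrite -Es2 -mulmxA s2w !mulmxDr -!scalemxAr Ev Ew1 En scaler0.
    by rewrite addr0.
  move/(congr1 (mulmx s3)): (s2w').
  rewrite mulmxA s3s2 mul0mx mulmxDr -!scalemxAr.
  rewrite s3v s3w1 scaler0 addr0 => /esym/eqP.
  rewrite scaler_eq0 (negPf n0) orbF => /eqP a0.
  by rewrite s2w' a0 scale0r add0r.
have [b0 | b0] := eqVneq b 0.
  have Tu := indep w1 Ew1 w1v.
  exists (col3 v w1 n); first by rewrite col_col3.
  apply: Or32; split.
  - apply: (mem_conj Tu ES); rewrite mul_col3 col3_mul !col3_mulv !mxE /=.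
    by rewrite Ev Ew1 En !(add0r, addr0, scale0r, scale1r).
  - apply: (mem_conj Tu s2S); rewrite mul_col3 col3_mul !col3_mulv !mxE /=.
    by rewrite s2v s2w1 b0 (Sker _ s2 n) // !(add0r, addr0, scale0r, scale1r).
  - apply: (mem_conj Tu s3S); rewrite mul_col3 col3_mul !col3_mulv !mxE /=.
    by rewrite s3v s3w1 s3n !(add0r, addr0, scale0r, scale1r).
(* Rescaling turns s2, which acts on w1 as the scalar b, into an idempotent. *)
pose w2 := b^-1 *: w1; pose t2 := b^-1 *: s2.
have Ew2 : E *m w2 = w2 by rewrite -scalemxAr Ew1.
have w2v : w2 \notin <[v]>%VS.
  by apply: contra w1v => w2v; rewrite -(scalerKV b0 w1) memvZ.
have Tu := indep w2 Ew2 w2v.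
exists (col3 v w2 n); first by rewrite col_col3.
have t2S : t2 \in S by rewrite memvZ.
have t2v : t2 *m v = w2 by rewrite -scalemxAl s2v.
have t2w2 : t2 *m w2 = w2.
  by rewrite -scalemxAl -scalemxAr s2w1 [b^-1 *: (b *: _)]scalerK.
have s3w2 : s3 *m w2 = 0 by rewrite -scalemxAr s3w1 scaler0.
apply: Or33; split.
- apply: (mem_conj Tu ES); rewrite mul_col3 col3_mul !col3_mulv !mxE /=.
  by rewrite Ev Ew2 En !(add0r, addr0, scale0r, scale1r).
- apply: (mem_conj Tu t2S); rewrite mul_col3 col3_mul !col3_mulv !mxE /=.
  by rewrite t2v t2w2 (Sker _ t2 n) // !(add0r, addr0, scale0r, scale1r).
- apply: (mem_conj Tu s3S); rewrite mul_col3 col3_mul !col3_mulv !mxE /=.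
  by rewrite s3v s3w2 s3n !(add0r, addr0, scale0r, scale1r).
Qed.

(** * The three decompositions *)

Lemma e_delta (R : realType) (i j : 'I_3) : e R i.+1 j.+1 = delta_mx i j.
Proof. by rewrite /e /= !inord_val. Qed.

Lemma eE (R : realType) :
  [/\ [/\ e R 1 1 = delta_mx 0 0, e R 1 2 = delta_mx 0 1
        & e R 1 3 = delta_mx 0 ord_max],
      [/\ e R 2 1 = delta_mx 1 0, e R 2 2 = delta_mx 1 1
        & e R 2 3 = delta_mx 1 ord_max]
    & [/\ e R 3 1 = delta_mx ord_max 0, e R 3 2 = delta_mx ord_max 1
        & e R 3 3 = delta_mx ord_max ord_max]].
Proof.
do ! split.
- exact: (e_delta R 0 0).
- exact: (e_delta R 0 1).
- exact: (e_delta R 0 ord_max).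
- exact: (e_delta R 1 0).
- exact: (e_delta R 1 1).
- exact: (e_delta R 1 ord_max).
- exact: (e_delta R ord_max 0).
- exact: (e_delta R ord_max 1).
- exact: (e_delta R ord_max ord_max).
Qed.

Lemma mem_summand6 (R : realType) (X : 'M[R[i]]_3) :
  (X \in summand6 R) = (X *m (delta_mx 0 0 : 'cV_3) == 0).
Proof.
have [[_ e12 e13] [_ e22 e23] [_ e32 e33]] := eE R.
apply/idP/idP => [|X0].
  pose f : 'Hom('M[R[i]]_3, 'cV[R[i]]_3) := linfun (mulmxr (delta_mx 0 0)).
  have : (summand6 R <= lker f)%VS.
    apply/span_subvP => Y; rewrite !inE e12 e13 e22 e23 e32 e33 memv_ker lfunE /=.
    by do ![case/orP] => /eqP ->; rewrite mul_delta_mx_0.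
  by move/subvP => sub /sub; rewrite memv_ker lfunE.
have Xi0 i : X i 0 = 0 by move/eqP/colP/(_ i): X0; rewrite -colE !mxE.
rewrite [X]matrix_sum_delta; apply: memv_suml => i _; apply: memv_suml => j _.
have [->|j0] := eqVneq j 0; first by rewrite Xi0 scale0r mem0v.
rewrite memvZ // memv_span // !inE e12 e13 e22 e23 e32 e33.
case: i => [[|[|[|i]]] hi] //; case: j j0 => [[|[|[|j]]] hj] // _.
all: do ![by apply/orP; left; apply/eqP; congr delta_mx; apply: val_inj
         | apply/orP; right].
all: by apply/eqP; congr delta_mx; apply: val_inj.
Qed.

Lemma mem_span3 (F : fieldType) n (a b c x : 'M[F]_n) :
  reflect (exists k : F * F * F, x = k.1.1 *: a + k.1.2 *: b + k.2 *: c)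
    (x \in <<[:: a; b; c]>>%VS).
Proof.
rewrite !span_cons span_nil addv0.
apply: (iffP memv_addP) => [[_ /vlineP[k ->] [_ /memv_addP[y yb [z zc ->]] ->]]|].
  move: yb zc => /vlineP[l ->] /vlineP[m ->].
  by exists (k, l, m); rewrite /= addrA.
case=> -[[k l] m] ->.
exists (k *: a); first by rewrite memvZ ?memv_line.
exists (l *: b + m *: c); last by rewrite addrA.
by apply: memv_add; rewrite memvZ ?memv_line.
Qed.

Lemma is_subalgebra_span (R : realType) (X : seq 'M[R[i]]_3) :
  (forall x y, x \in X -> y \in X -> x *m y \in <<X>>%VS) -> is_subalgebra <<X>>.
Proof.
move=> gen x y xX yX.
have left z : z \in X -> z *m y \in <<X>>%VS.
  move=> zX; have /subvP/(_ y yX) : (<<X>> <= linfun (mulmx z) @^-1: <<X>>)%VS.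
    by apply/span_subvP => t tX; rewrite -memv_preim lfunE /= gen.
  by rewrite -memv_preim lfunE.
have /subvP/(_ x xX) : (<<X>> <= linfun (mulmxr y) @^-1: <<X>>)%VS.
  by apply/span_subvP => t tX; rewrite -memv_preim lfunE /= left.
by rewrite -memv_preim lfunE.
Qed.

(** When the first columns of a, b, c are the canonical basis, their span is
    complementary to the matrices with zero first column; a zero corner entry
    excludes the identity. *)
Lemma nonunital_36_with_summand6 (R : realType) (a b c : 'M[R[i]]_3) :
  is_subalgebra <<[:: a; b; c]>> ->
  col 0 a = delta_mx 0 0 -> col 0 b = delta_mx 1 0 ->
  col 0 c = delta_mx ord_max 0 ->
  a ord_max ord_max = 0 -> b ord_max ord_max = 0 -> c ord_max ord_max = 0 ->
  is_nonunital_36 <<[:: a; b; c]>> (summand6 R).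
Proof.
move=> alg a0 b0 c0 a2 b2 c2; set S := <<_>>%VS.
have sumSM : (S + summand6 R)%VS = fullv.
  apply/vspaceP => X; rewrite memvf; apply/memv_addP.
  pose s := X 0 0 *: a + X 1 0 *: b + X ord_max 0 *: c.
  exists s; first by apply/mem_span3; exists (X 0 0, X 1 0, X ord_max 0).
  exists (X - s); last by rewrite addrC subrK.
  rewrite mem_summand6 mulmxBl subr_eq0 -!colE /s !linearD !linearZ /= a0 b0 c0.
  apply/eqP/colP => -[[|[|[|i]]] hi] //;
  rewrite !mxE /= ?(mulr0, mulr1, addr0, add0r);
  by congr (X _ _); apply: val_inj.
have dS : (\dim S <= 3)%N by apply: dim_span.
have dM : (\dim (summand6 R) <= 6)%N by apply: dim_span.
have dSM := dimv_sum_cap S (summand6 R); rewrite sumSM dim_fullmx in dSM.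
have dS3 : \dim S = 3%N.
  apply/eqP; rewrite eqn_leq dS -(leq_add2r 6).
  by rewrite (leq_trans _ (leq_add (leqnn _) dM)) // -dSM leq_addr.
have dM6 : \dim (summand6 R) = 6%N.
  apply/eqP; rewrite eqn_leq dM -(leq_add2l 3).
  by rewrite (leq_trans _ (leq_add dS (leqnn _))) // -dSM leq_addr.
have cap0 : (S :&: summand6 R = 0)%VS.
  apply/eqP; rewrite -dimv_eq0; move/eqP: dSM.
  by rewrite dS3 dM6 -[X in _ == X]addn0 eqn_add2l.
split=> //.
- split=> // X Y; rewrite !mem_summand6 => _ /eqP Y0.
  by rewrite -mulmxA Y0 mulmx0.
- apply/mem_span3 => -[k] /matrixP/(_ ord_max ord_max)/eqP.
  by rewrite !mxE a2 b2 c2 !mulr0 !addr0 oner_eq0.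
- rewrite mem_summand6 mul1mx; apply/eqP => /matrixP/(_ 0 0)/eqP.
  by rewrite !mxE oner_eq0.
Qed.

Lemma nonunital_A1 (R : realType) : is_nonunital_36 (A1 R).1 (A1 R).2.
Proof.
have [[e11 _ _] [e21 e22 _] [e31 _ _]] := eE R.
rewrite /= e11 e21 e31; apply: nonunital_36_with_summand6.
(* Every product of two generators is zero or a generator. *)
- apply: is_subalgebra_span => x y; rewrite !inE.
  by do 2![case/or3P => /eqP ->]; rewrite ?mulmxDl ?mulmxDr ?mul_delta_mx;
     rewrite ?mul_delta_mx_0 ?addr0 ?add0r ?mem0v // memv_span // !inE eqxx ?orbT.
1-3: by apply/colP => -[[|[|[|i]]] hi] //; rewrite !mxE /= ?addr0.
all: by rewrite !mxE /= ?addr0.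
Qed.

Lemma nonunital_A2 (R : realType) : is_nonunital_36 (A2 R).1 (A2 R).2.
Proof.
have [[e11 _ _] [e21 e22 _] [e31 _ _]] := eE R.
rewrite /= e11 e21 e22 e31; apply: nonunital_36_with_summand6.
- apply: is_subalgebra_span => x y; rewrite !inE.
  by do 2![case/or3P => /eqP ->]; rewrite ?mulmxDl ?mulmxDr ?mul_delta_mx;
     rewrite ?mul_delta_mx_0 ?addr0 ?add0r ?mem0v // memv_span // !inE eqxx ?orbT.
1-3: by apply/colP => -[[|[|[|i]]] hi] //; rewrite !mxE /= ?addr0.
all: by rewrite !mxE /= ?addr0.
Qed.

Lemma nonunital_A3 (R : realType) : is_nonunital_36 (A3 R).1 (A3 R).2.
Proof.
have [[e11 _ _] [e21 e22 _] [e31 _ _]] := eE R.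
rewrite /= e11 e21 e22 e31; apply: nonunital_36_with_summand6.
- apply: is_subalgebra_span => x y; rewrite !inE.
  by do 2![case/or3P => /eqP ->]; rewrite ?mulmxDl ?mulmxDr ?mul_delta_mx;
     rewrite ?mul_delta_mx_0 ?addr0 ?add0r ?mem0v // memv_span // !inE eqxx ?orbT.
1-3: by apply/colP => -[[|[|[|i]]] hi] //; rewrite !mxE /= ?addr0.
all: by rewrite !mxE /= ?addr0.
Qed.

(** * Reduction to the three decompositions *)

Definition conjugation (R : realType) (T : 'M[R[i]]_3) : 'End('M[R[i]]_3) :=
  linfun (mulmxr T \o mulmx (invmx T)).

Lemma conjugationE (R : realType) (T X : 'M[R[i]]_3) :
  conjugation T X = invmx T *m X *m T.
Proof. by rewrite lfunE. Qed.

Lemma is_automorphism_conjugation (R : realType) (T : 'M[R[i]]_3) :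
  T \in unitmx -> is_automorphism (conjugation T).
Proof.
move=> Tu; split=> [|X Y].
  exists (fun X => T *m X *m invmx T) => X; rewrite conjugationE.
    by rewrite !mulmxA mulmxV // mul1mx mulmxK.
  by rewrite !mulmxA mulVmx // mul1mx mulmxKV.
by rewrite !conjugationE !mulmxA mulmxK.
Qed.

Lemma mem_conjugation_img (R : realType) (T : 'M[R[i]]_3)
    (U : {vspace 'M[R[i]]_3}) X :
  T \in unitmx -> T *m X *m invmx T \in U -> X \in (conjugation T @: U)%VS.
Proof.
move=> Tu TX; apply/memv_imgP; exists (T *m X *m invmx T) => //.
by rewrite conjugationE !mulmxA mulVmx // mul1mx mulmxKV.
Qed.

Lemma conjugation_img (R : realType) (T : 'M[R[i]]_3)
    (U V : {vspace 'M[R[i]]_3}) :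
  T \in unitmx -> \dim U = \dim V -> (V <= conjugation T @: U)%VS ->
  (conjugation T @: U)%VS = V.
Proof.
move=> Tu dUV VU; apply/eqP; rewrite eq_sym eqEdim VU -dUV.
by rewrite -[X in (_ <= X)%N](limg_ker_dim (conjugation T)) leq_addl.
Qed.

Lemma carries_of_annihilator (R : realType) (S M : {vspace 'M[R[i]]_3})
    (v : 'cV[R[i]]_3) :
  is_nonunital_36 S M -> v != 0 -> (forall X, (X \in M) = (X *m v == 0)) ->
  exists2 phi : 'End('M[R[i]]_3), is_automorphism phi &
    [\/ carries phi (S, M) (A1 R), carries phi (S, M) (A2 R)
      | carries phi (S, M) (A3 R)].
Proof.
move=> [[SM MM sumSM capSM] dS dM S1 M1] v0 Mv.
have ex x : exists2 s, s \in S & s *m v = x.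
  have [w wv] := exists_dual_row v0.
  have : x *m w \in (S + M)%VS by rewrite sumSM memvf.
  case/memv_addP => s sS [m]; rewrite Mv => /eqP mv xw; exists s => //.
  by rewrite -[x]mulmx1 -wv mulmxA xw mulmxDl mv addr0.
have inj0 s : s \in S -> s *m v = 0 -> s = 0.
  move=> sS sv; apply/eqP; rewrite -memv0 -capSM memv_cap sS Mv sv.
  exact: eqxx.
have [T [Tu Tv] TS] := nonunital_complement_normal_form SM S1 v0 ex inj0.
have [_ dA1 d6 _ _] := nonunital_A1 R.
have [_ dA2 _ _ _] := nonunital_A2 R.
have [_ dA3 _ _ _] := nonunital_A3 R.
have [[e11 _ _] [e21 e22 _] [e31 _ _]] := eE R.
have imgM : (conjugation T @: M)%VS = summand6 R.
  apply: (conjugation_img Tu (etrans dM (esym d6))); apply/subvP => X.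
  rewrite mem_summand6 => /eqP X0; apply: mem_conjugation_img => //.
  by rewrite Mv -Tv colE -!mulmxA mulKmx // X0 mulmx0.
have imgS a b c : \dim <<[:: a; b; c]>> = 3%N ->
    T *m a *m invmx T \in S -> T *m b *m invmx T \in S ->
    T *m c *m invmx T \in S -> (conjugation T @: S)%VS = <<[:: a; b; c]>>%VS.
  move=> dX aS bS cS; apply: (conjugation_img Tu (etrans dS (esym dX))).
  apply/span_subvP => x; rewrite !inE.
  by case/or3P => /eqP ->; apply: (mem_conjugation_img Tu);
    [exact: aS | exact: bS | exact: cS].
exists (conjugation T); first exact: is_automorphism_conjugation.
case: TS; rewrite -?e11 -?e21 -?e22 -?e31 => -[h1 h2 h3].
- by apply: Or31; split; [exact: (imgS _ _ _ dA1 h1 h2 h3) | exact: imgM].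
- by apply: Or32; split; [exact: (imgS _ _ _ dA2 h1 h2 h3) | exact: imgM].
- by apply: Or33; split; [exact: (imgS _ _ _ dA3 h1 h2 h3) | exact: imgM].
Qed.

Lemma transposed_nonunital (R : realType) (S M : {vspace 'M[R[i]]_3}) :
  is_nonunital_36 S M ->
  is_nonunital_36 (transposition R @: S) (transposition R @: M).
Proof.
move=> [[SM MM sumSM capSM] dS dM S1 M1].
have tE X : transposition R X = X^T by rewrite lfunE.
have mem U X : (X^T \in (transposition R @: U)%VS) = (X \in U).
  apply/memv_imgP/idP => [[Y YU]|XU]; last by exists X; rewrite ?tE.
  by rewrite tE => /trmx_inj ->.
have ker0 : lker (transposition R) == 0%VS.
  by apply/lker0P => X Y; rewrite !tE => /trmx_inj.
have sub U : is_subalgebra U -> is_subalgebra (transposition R @: U)%VS.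
  move=> UM X Y; rewrite -[X]trmxK -[Y]trmxK -trmx_mul !mem => XU YU.
  exact: UM.
have dimt U : \dim (transposition R @: U) = \dim U.
  by rewrite limg_dim_eq // (eqP ker0) capv0.
split; rewrite ?dimt // -1?trmx1 ?mem //.
split; [exact: sub | exact: sub | | ].
  by rewrite -limgD sumSM; apply/vspaceP => X; rewrite -[X]trmxK mem !memvf.
by rewrite -lker0_img_cap // capSM limg0.
Qed.

Lemma nonunital_36_classification (R : realType) (S M : {vspace 'M[R[i]]_3}) :
  is_nonunital_36 S M ->
  [\/ equiv_up_to_transpose (S, M) (A1 R), equiv_up_to_transpose (S, M) (A2 R)
    | equiv_up_to_transpose (S, M) (A3 R)].
Proof.
move=> SM36; have [[_ MM _ _] _ dM _ M1] := SM36.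
have [[v v0 Mv] | [w w0 Mw]] := nonunital_preserves_line MM M1 dM.
  have annM := nonunital_stabilizer_is_annihilator MM M1 dM v0 Mv.
  have [phi phiA] := carries_of_annihilator SM36 v0 annM.
  by case=> c; [apply: Or31 | apply: Or32 | apply: Or33];
     exists phi; split=> //; left.
have SMt := transposed_nonunital SM36.
have [[_ tMM _ _] _ tdM _ tM1] := SMt.
have wt0 : w^T != 0 by rewrite trmx_eq0.
have Mwt X : X \in (transposition R @: M)%VS -> exists c, X *m w^T = c *: w^T.
  case/memv_imgP => Y /Mw[c wY] ->; exists c.
  by rewrite lfunE /= -trmx_mul wY linearZ.
have annM := nonunital_stabilizer_is_annihilator tMM tM1 tdM wt0 Mwt.
have [phi phiA] := carries_of_annihilator SMt wt0 annM.
by case=> -[/= cS cM]; [apply: Or31 | apply: Or32 | apply: Or33];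
   exists phi; split=> //; right; split; rewrite /= limg_comp.
Qed.

(** * Separation of the orbits *)

(** Squares do not see the order of the factors, so automorphisms and
    antiautomorphisms need not be distinguished. *)
Lemma same_orbit_squares (R : realType)
    (D D' : {vspace 'M[R[i]]_3} * {vspace 'M[R[i]]_3}) :
  same_orbit D D' -> exists f : 'End('M[R[i]]_3),
    [/\ injective f, forall x, f (x *m x) = f x *m f x & (f @: D.1)%VS = D'.1].
Proof.
by case=> f [[] [fbij fM] [fS _]]; exists f; split=> //; exact: bij_inj.
Qed.

(** x is a column times the first coordinate row, so x *m x is the multiple of
    x by its corner entry. *)
Lemma square_in_first_column (F : fieldType) (a b c : F) :
  let x : 'M[F]_3 :=
    a *: delta_mx 0 0 + b *: delta_mx 1 0 + c *: delta_mx ord_max 0 in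
  x *m x = a *: x.
Proof.
move=> x; have xd : x *m delta_mx 0 0 = x.
  by rewrite !mulmxDl -!scalemxAl !mul_delta_mx.
have dx : (delta_mx 0 0 : 'M_3) *m x = a *: delta_mx 0 0.
  rewrite !mulmxDr -!scalemxAr mul_delta_mx !mul_delta_mx_0 //.
  by rewrite !scaler0 !addr0.
by rewrite -{1}xd -mulmxA dx -scalemxAr xd.
Qed.

Lemma square_unit_plus_nilpotent (F : fieldType) (c : F) :
  let y : 'M[F]_3 := delta_mx 0 0 + delta_mx 1 1 + delta_mx 1 0 in
  y *m y <> c *: y.
Proof.
move=> y /matrixP yy; move: (yy 0 0) (yy 1 0).
rewrite !mxE !big_ord_recl !big_ord0 !mxE /=.
rewrite !(mulr0, mul0r, addr0, add0r, mulr1) => <- /eqP.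
by rewrite -subr_eq0 addrK oner_eq0.
Qed.

Lemma square_unit_plus_idempotent (F : fieldType) (c : F) :
  2%:R != 0 :> F ->
  let y : 'M[F]_3 :=
    delta_mx 0 0 + delta_mx 1 1 + (delta_mx 1 0 + delta_mx 1 1) in
  y *m y <> c *: y.
Proof.
move=> two y /matrixP yy; move: (yy 0 0) (yy 1 0).
rewrite !mxE !big_ord_recl !big_ord0 !mxE /=.
rewrite !(mulr0, mul0r, addr0, add0r, mulr1) => <- /eqP.
by rewrite addrA -subr_eq0 addrK (negPf two).
Qed.

Lemma square_zero_in_A3 (F : fieldType) (a b c : F) :
  let x : 'M[F]_3 := a *: (delta_mx 0 0 + delta_mx 1 1)
     + b *: (delta_mx 1 0 + delta_mx 1 1) + c *: delta_mx ord_max 0 in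
  x *m x = 0 -> x = c *: delta_mx ord_max 0.
Proof.
move=> x /matrixP xx.
have a0 : a = 0.
  move/eqP: (xx 0 0); rewrite !mxE !big_ord_recl big_ord0 !mxE /=.
  by rewrite !(mulr0, mul0r, addr0, add0r, mulr1) mulf_eq0 orbb => /eqP.
have b0 : b = 0.
  move/eqP: (xx 1 1); rewrite !mxE !big_ord_recl big_ord0 !mxE /= a0.
  by rewrite !(mulr0, mul0r, addr0, add0r, mulr1) mulf_eq0 orbb => /eqP.
by rewrite /x a0 b0 !scale0r !add0r.
Qed.

Lemma not_same_orbit_A1 (R : realType)
    (D : {vspace 'M[R[i]]_3} * {vspace 'M[R[i]]_3}) (y : 'M[R[i]]_3) :
  y \in D.1 -> (forall c, y *m y <> c *: y) -> ~ same_orbit (A1 R) D.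
Proof.
move=> yD ny /same_orbit_squares[f [finj fM fS]].
have [[e11 _ _] [e21 _ _] [e31 _ _]] := eE R.
move: yD ny; rewrite -fS /= e11 e21 e31.
case/memv_imgP => x /mem_span3[k xE] -> /(_ k.1.1); apply.
by rewrite -fM -linearZ xE square_in_first_column.
Qed.

Lemma A1_A2_not_same_orbit (R : realType) : ~ same_orbit (A1 R) (A2 R).
Proof.
have [[e11 _ _] [e21 e22 _] _] := eE R.
apply: (@not_same_orbit_A1 _ _ (e R 1 1 + e R 2 2 + e R 2 1)).
  by apply: memvD; apply: memv_span; rewrite !inE eqxx ?orbT.
by move=> c; rewrite e11 e21 e22; apply: square_unit_plus_nilpotent.
Qed.

Lemma A1_A3_not_same_orbit (R : realType) : ~ same_orbit (A1 R) (A3 R).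
Proof.
have [[e11 _ _] [e21 e22 _] _] := eE R.
apply: (@not_same_orbit_A1 _ _ (e R 1 1 + e R 2 2 + (e R 2 1 + e R 2 2))).
  by apply: memvD; apply: memv_span; rewrite !inE eqxx ?orbT.
move=> c; rewrite e11 e21 e22; apply: square_unit_plus_idempotent.
by rewrite Num.Theory.pnatr_eq0.
Qed.

(** The images of the square-zero elements e_21 and e_31 would both lie on the
    line of e_31, against injectivity. *)
Lemma A2_A3_not_same_orbit (R : realType) : ~ same_orbit (A2 R) (A3 R).
Proof.
case/same_orbit_squares => f [finj fM fS].
have [[e11 _ _] [e21 e22 _] [e31 _ _]] := eE R.
have img x : x \in (A2 R).1 -> x *m x = 0 -> exists c, f x = c *: e R 3 1.
  move=> xA xx; have : f x \in (A3 R).1 by rewrite -fS memv_img.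
  have : f x *m f x = 0 by rewrite -fM xx linear0.
  rewrite /= e11 e21 e22 e31 => fxx /mem_span3[k fx].
  by exists k.2; rewrite fx in fxx *; apply: square_zero_in_A3 fxx.
have [||k fk] := img (e R 2 1).
- by apply: memv_span; rewrite !inE eqxx ?orbT.
- by rewrite e21 mul_delta_mx_0.
have [||l fl] := img (e R 3 1).
- by apply: memv_span; rewrite !inE eqxx ?orbT.
- by rewrite e31 mul_delta_mx_0.
(* f takes the same value l * k *: e_31 on both sides. *)
have lk : l *: e R 2 1 = k *: e R 3 1.
  by apply: finj; rewrite !linearZ /= fk fl !scalerA mulrC.
have l0 : l = 0.
  have := congr1 (mulmx (delta_mx 0 1 : 'M_3)) lk.
  rewrite e21 e31 -!scalemxAr mul_delta_mx mul_delta_mx_0 // scaler0 => /eqP.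
  by rewrite scaler_eq0 (negPf (delta_mx_neq0 _ _ _)) orbF => /eqP.
have /eqP : e R 3 1 = 0 by apply: finj; rewrite fl l0 scale0r linear0.
by rewrite e31 (negPf (delta_mx_neq0 _ _ _)).
Qed.

Theorem theorem1 (R : realType) :
  [/\ is_nonunital_36 (A1 R).1 (A1 R).2,
      is_nonunital_36 (A2 R).1 (A2 R).2
    & is_nonunital_36 (A3 R).1 (A3 R).2] /\
  (forall S M : {vspace 'M[R[i]]_3}, is_nonunital_36 S M ->
     [\/ equiv_up_to_transpose (S, M) (A1 R),
         equiv_up_to_transpose (S, M) (A2 R)
       | equiv_up_to_transpose (S, M) (A3 R)]) /\
  [/\ ~ same_orbit (A1 R) (A2 R),
      ~ same_orbit (A1 R) (A3 R)
    & ~ same_orbit (A2 R) (A3 R)].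
Proof.
split.
  by split; [exact: nonunital_A1 | exact: nonunital_A2 | exact: nonunital_A3].
split; first exact: nonunital_36_classification.
split; [exact: A1_A2_not_same_orbit | exact: A1_A3_not_same_orbit |].
exact: A2_A3_not_same_orbit.
Qed.
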